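(* Let $A$ be a $2n\times 2n$ real symmetric matrix. Then $A\in\operatorname{SpS}(2n)$ if and only if there exist symplectic orthogonal projections $\Pi_-,\Pi_0,\Pi_+$ (real $2n\times 2n$ matrices) satisfying the following conditions: (i) $\Pi_-\Pi_0=\Pi_-\Pi_+=\Pi_0\Pi_+=0$ and $\Pi_-+\Pi_0+\Pi_+=I_{2n}$; (ii) $A=\Pi_-^{\top}A\Pi_-+\Pi_+^{\top}A\Pi_+$; (iii) $\Pi_-^{\top}A\Pi_-$ is negative definite on $\operatorname{range}(\Pi_-)$ and $\Pi_+^{\top}A\Pi_+$ is positive definite on $\operatorname{range}(\Pi_+)$.
   Context: $J=J_{2n}=\begin{pmatrix}0&I_n\\-I_n&0\end{pmatrix}$ and $\langle x,y\rangle=x^{\top}y$. For a subset $\mathscr{X}\subseteq\mathbb{R}^{2n}$, $\mathscr{X}^{\perp_{\operatorname{s}}}=\{u\in\mathbb{R}^{2n}:\langle u,Jv\rangle=0\ \forall v\in\mathscr{X}\}$. A linear subspace $\mathscr{W}$ is a symplectic subspace if $\mathscr{W}\cap\mathscr{W}^{\perp_{\operatorname{s}}}=\{0\}$ (the zero subspace is allowed); in that case $\mathbb{R}^{2n}=\mathscr{W}\oplus\mathscr{W}^{\perp_{\operatorname{s}}}$. Symplectic subspaces $\mathscr{W},\mathscr{Z}$ are symplectically orthogonal to each other if $\mathscr{Z}\subseteq\mathscr{W}^{\perp_{\operatorname{s}}}$. The symplectic orthogonal projection onto a symplectic subspace $\mathscr{W}$ is the $2n\times 2n$ real matrix $\Pi$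 with $\Pi x=x$ for $x\in\mathscr{W}$ and $\Pi x=0$ for $x\in\mathscr{W}^{\perp_{\operatorname{s}}}$; a symplectic orthogonal projection is a matrix of this form for some symplectic subspace $\mathscr{W}$. A symmetric matrix $A$ is positive definite on a subspace $\mathscr{W}$ if $\langle w,Aw\rangle>0$ for all nonzero $w\in\mathscr{W}$, and negative definite on $\mathscr{W}$ if $-A$ is positive definite on $\mathscr{W}$. $\nu(A),\xi(A),\pi(A)$ denote the numbers of negative, zero, and positive eigenvalues of $A$ (with multiplicity). $\operatorname{SpS}(2n)$ is the set of $2n\times 2n$ real symmetric matrices $A$ for which there exist pairwise symplectically orthogonal symplectic subspaces $\mathscr{W}_-,\mathscr{W}_0,\mathscr{W}_+$ of $\mathbb{R}^{2n}$ with dimensions $\nu(A),\xi(A),\pi(A)$, respectively, such that each of them is invariant under $JA$, $A$ is negative definite on $\mathscr{W}_-$, $\ker(A)=\mathscr{W}_0$, and $A$ is positive definite on $\mathscr{W}_+$. *)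

(* Defs.v *)
From HB Require Import structures.
From mathcomp Require Import all_boot all_order all_algebra.
From mathcomp Require Import polyrcf reals.

Set Implicit Arguments.
Unset Strict Implicit.
Unset Printing Implicit Defensive.

Import Order.TTheory GRing.Theory Num.Theory.

Local Open Scope ring_scope.

Definition Jmx (R : realType) (n : nat) : 'M[R]_(n + n) :=
  block_mx 0 1%:M (- 1%:M) 0.

Definition inner (R : realType) (m : nat) (x y : 'cV[R]_m) : R :=
  (x^T *m y) 0 0.

(* Matrices act on column vectors on the left, so subspaces of R^m are taken
   in ['cV_m], not as the row spaces of the [%MS] scope. *)
Definition mxend (R : realType) (m : nat) (A : 'M[R]_m) : 'End('cV[R]_m) :=
  linfun (mulmx A).

Definition mxker (R : realType) (m : nat) (A : 'M[R]_m) : {vspace 'cV[R]_m} :=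
  lker (mxend A).

Definition mxrange (R : realType) (m : nat) (A : 'M[R]_m) :
  {vspace 'cV[R]_m} := limg (mxend A).

Definition mxinvariant (R : realType) (m : nat) (A : 'M[R]_m)
  (W : {vspace 'cV[R]_m}) : Prop := (mxend A @: W <= W)%VS.

Definition in_symp_perp (R : realType) (n : nat)
  (X : {pred 'cV[R]_(n + n)}) (u : 'cV[R]_(n + n)) : Prop :=
  forall v, v \in X -> inner u (Jmx R n *m v) = 0.

Definition symplectic_subspace (R : realType) (n : nat)
  (W : {vspace 'cV[R]_(n + n)}) : Prop :=
  forall x, x \in W -> in_symp_perp W x -> x = 0.

Definition symp_orthogonal (R : realType) (n : nat)
  (W Z : {vspace 'cV[R]_(n + n)}) : Prop :=
  forall z, z \in Z -> in_symp_perp W z.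

Definition symp_proj_onto (R : realType) (n : nat)
  (W : {vspace 'cV[R]_(n + n)}) (P : 'M[R]_(n + n)) : Prop :=
  (forall x, x \in W -> P *m x = x) /\
  (forall x, in_symp_perp W x -> P *m x = 0).

Definition symp_orth_projection (R : realType) (n : nat)
  (P : 'M[R]_(n + n)) : Prop :=
  exists W : {vspace 'cV[R]_(n + n)},
    symplectic_subspace W /\ symp_proj_onto W P.

Definition posdef_on (R : realType) (m : nat) (A : 'M[R]_m)
  (W : {vspace 'cV[R]_m}) : Prop :=
  forall w, w \in W -> w != 0 -> 0 < inner w (A *m w).

Definition negdef_on (R : realType) (m : nat) (A : 'M[R]_m)
  (W : {vspace 'cV[R]_m}) : Prop := posdef_on (- A) W.

(* [rootsR] lists each real root once; [mup x p] is its multiplicity in [p]. *)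
Definition num_eig (R : realType) (m : nat) (S : pred R) (A : 'M[R]_m) : nat :=
  (\sum_(x <- rootsR (char_poly A) | S x) mup x (char_poly A))%N.

Definition num_neg_eig (R : realType) (m : nat) (A : 'M[R]_m) : nat :=
  num_eig (fun x => x < 0) A.

Definition num_zero_eig (R : realType) (m : nat) (A : 'M[R]_m) : nat :=
  num_eig (fun x => x == 0) A.

Definition num_pos_eig (R : realType) (m : nat) (A : 'M[R]_m) : nat :=
  num_eig (fun x => 0 < x) A.

Definition SpS (R : realType) (n : nat) (A : 'M[R]_(n + n)) : Prop :=
  A^T = A /\
  exists Wm W0 Wp : {vspace 'cV[R]_(n + n)},
    [/\ [/\ symplectic_subspace Wm, symplectic_subspace W0
          & symplectic_subspace Wp],
        [/\ symp_orthogonal Wm W0, symp_orthogonal Wm Wp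
          & symp_orthogonal W0 Wp],
        [/\ \dim Wm = num_neg_eig A, \dim W0 = num_zero_eig A
          & \dim Wp = num_pos_eig A],
        [/\ mxinvariant (Jmx R n *m A) Wm, mxinvariant (Jmx R n *m A) W0
          & mxinvariant (Jmx R n *m A) Wp]
      & [/\ negdef_on A Wm, mxker A = W0 & posdef_on A Wp]].

(* Main.v *)
Require Import Defs.
From HB Require Import structures.
From mathcomp Require Import all_boot all_order all_algebra.
From mathcomp Require Import complex polyrcf reals zify.

(** The equivalence is a dictionary between pairwise symplectically orthogonal
    symplectic subspaces [Wm], [W0], [Wp] that span the space and their
    projections [Pm], [P0], [Pp].  It rests on three facts.

    A symplectic subspace carries exactly one symplectic orthogonal projection,
    given by an explicit matrix ([symp_projP], [symp_proj_unique]), and this matrix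
    satisfies [P^T J = J P] and [P J = J P^T] ([symp_proj_selfadjoint],
    [symp_proj_mulJ]).

    Orthogonality of subspaces is the vanishing of products of projections
    ([symp_proj_mul0P]), and invariance under [J A] corresponds to the block
    diagonal form [A = Pm^T A Pm + Pp^T A Pp]: self-adjointness turns
    [P J A] into [J P^T A], and [J] is invertible.

    The projections say nothing about eigenvalues, whereas the definition of
    [SpS] fixes the dimensions of the subspaces.  The link is Sylvester's law of
    inertia: a subspace on which [A] is negative definite, on which it is
    positive definite, or which lies in [ker A], has dimension at most the number
    of negative, positive, or zero eigenvalues respectively ([dim_negdef_le],
    [dim_posdef_le], [dim_null_le]).  These numbers add up to
    the dimension of the space ([sum_num_eig]), so all three bounds are equalities
    as soon as the subspaces span it.  Conversely, subspaces with these dimensions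
    span the space ([sum_symp_proj_eq1]).  Both uses need the real spectral
    theorem, proved here by induction with Householder reflections
    ([symmetric_spectral]). *)

Set Implicit Arguments.
Unset Strict Implicit.
Unset Printing Implicit Defensive.

Import Order.TTheory GRing.Theory Num.Theory.

Local Open Scope ring_scope.

(** * The spectral theorem for real symmetric matrices *)

(** Seen over the algebraically closed field [R[i]], [A] is Hermitian, hence
    unitarily diagonalizable with a real diagonal.  A diagonal entry lies in
    [R] and is an eigenvalue of the complexified matrix, and being an
    eigenvalue does not depend on the field. *)
Lemma symmetric_eigenvalue (R : rcfType) (n : nat) (A : 'M[R]_n.+1) :
  A^T = A -> exists a, eigenvalue A a.
Proof.
move=> A_sym; pose AC := map_mx (real_complex R) A.
have AC_herm : AC \is hermsymmx.
  apply: realsym_hermsym.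
    apply/is_hermitianmxP.
    by rewrite expr0 scale1r map_mx_id // map_trmx A_sym.
  by apply/mxOverP=> i j; rewrite mxE; apply/complex_realP; exists (A i j).
have /orthomx_spectralP AC_diag := hermitian_normalmx AC_herm.
have /mxOverP/(_ 0 ord0)/complex_realP[a a_diag] :=
  hermitian_spectral_diag_real AC_herm.
exists a; rewrite -(eigenvalue_map (real_complex R)) -/AC.
apply/eigenvalueP; exists (row ord0 (spectralmx AC)).
  rewrite -row_mul {2}AC_diag !mulmxA mulmxV ?spectral_unit // mul1mx.
  by rewrite row_mul row_diag_mx a_diag -scalemxAl -rowE.
apply: contraTneq (spectral_unit AC) => row0.
rewrite -row_free_unit; apply/negP => /row_freeP[B BP].
have := congr1 (row ord0) BP; rewrite row_mul row0 mul0mx row1.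
by move=> /rowP/(_ ord0); rewrite !mxE !eqxx => /eqP; rewrite eq_sym oner_eq0.
Qed.

Lemma mulmx_tr_gt0 (R : realFieldType) (n : nat) (v : 'rV[R]_n) :
  v != 0 -> 0 < (v *m v^T) 0 0.
Proof.
move=> v_neq0; have sqE : (v *m v^T) 0 0 = \sum_i v 0 i ^+ 2.
  by rewrite mxE; apply: eq_bigr => i _; rewrite mxE.
rewrite sqE lt_def sumr_ge0 ?andbT => [|i _]; last exact: sqr_ge0.
apply: contra v_neq0 => /eqP sum0; apply/eqP/rowP => i; rewrite mxE.
have /(_ i isT) := psumr_eq0P (fun j _ => sqr_ge0 (v 0 j)) sum0.
by move/eqP; rewrite sqrf_eq0 => /eqP.
Qed.

(** The Householder reflection exchanging the first basis vector [e] and [v]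
    has first row [v]: it is [1 - 2 u^T u / (u u^T)] with [u = e - v].  It gives an
    orthonormal completion of [v] without a Gram-Schmidt process. *)
Lemma householder (R : realFieldType) (n : nat) (v : 'rV[R]_n.+1) :
  v *m v^T = 1%:M ->
  exists2 H : 'M[R]_n.+1, H *m H^T = 1%:M & row ord0 H = v.
Proof.
move=> v_unit; pose e : 'rV[R]_n.+1 := delta_mx 0 ord0.
have [u uE] : {u : 'rV[R]_n.+1 | u = e - v} by exists (e - v).
have [u0|u_neq0] := eqVneq u 0.
  exists 1%:M; first by rewrite trmx1 mulmx1.
  by rewrite row1; apply/eqP; rewrite -subr_eq0 -uE u0.
pose s := (u *m u^T) 0 0; pose c := 2%:R / s.
have s_neq0 : s != 0 by rewrite gt_eqF // mulmx_tr_gt0.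
have uuT : u *m u^T = s%:M by rewrite [LHS]mx11_scalar.
exists (1%:M - c *: (u^T *m u)).
  have -> : (1%:M - c *: (u^T *m u))^T = 1%:M - c *: (u^T *m u).
    by rewrite raddfB /= trmx1 [(_ *: _)^T]linearZ /= trmx_mul trmxK.
  rewrite mulmxBl mul1mx mulmxBr mulmx1 -scalemxAl -scalemxAr.
  rewrite mulmxA -(mulmxA u^T) uuT mul_mx_scalar -scalemxAl !scalerA.
  rewrite -addrA -opprD -scalerBl -scalerDl.
  suff -> : c + (c - c * (c * s)) = 0 by rewrite scale0r subr0.
  by rewrite [c * s]mulfVK // mulr_natr mulr2n addrA subrr.
have eeT : e *m e^T = 1%:M.
  by rewrite trmx_delta mul_delta_mx; apply/matrixP => i j; rewrite !ord1 !mxE.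
have veT : v *m e^T = e *m v^T.
  by rewrite [LHS]mx11_scalar -tr_scalar_mx -mx11_scalar trmx_mul trmxK.
have euT : (e *m u^T) 0 0 *+ 2 = s.
  suff /matrixP/(_ 0 0) : e *m u^T + e *m u^T = u *m u^T by rewrite mxE.
  rewrite uE linearB /= mulmxBl !mulmxBr v_unit veT eeT.
  by rewrite opprB.
rewrite rowE -/e mulmxBr mulmx1 -scalemxAr mulmxA [e *m u^T]mx11_scalar.
rewrite mul_scalar_mx scalerA /c mulrAC mulr_natl euT divff // scale1r.
by rewrite uE opprB addrC subrK.
Qed.

(** Induction on the size: conjugating by an orthogonal matrix whose first row
    is a unit eigenvector clears the first row of [A] outside the diagonal,
    and the first column by symmetry, leaving a smaller symmetric block. *)
Lemma symmetric_spectral (R : rcfType) (n : nat) (A : 'M[R]_n) :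
  A^T = A ->
  exists (Q : 'M[R]_n) (d : 'rV[R]_n),
    Q *m Q^T = 1%:M /\ A = Q^T *m diag_mx d *m Q.
Proof.
elim: n A => [|n IHn] A A_sym.
  by exists 0, 0; split; apply/matrixP => -[].
have [a /eigenvalueP[v0 v0A v0_neq0]] := symmetric_eigenvalue A_sym.
pose r := Num.sqrt ((v0 *m v0^T) 0 0); pose v := r^-1 *: v0.
have r_neq0 : r != 0 by rewrite sqrtr_eq0 -ltNge mulmx_tr_gt0.
have v_unit : v *m v^T = 1%:M.
  rewrite /v linearZ /= -scalemxAl -scalemxAr scalerA [v0 *m _]mx11_scalar.
  rewrite -(sqr_sqrtr (ltW (mulmx_tr_gt0 v0_neq0))) -/r scale_scalar_mx.
  by rewrite expr2 mulrACA mulVf // mul1r.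
have vA : v *m A = a *: v by rewrite -scalemxAl v0A !scalerA mulrC.
have [H HHT Hv] := householder v_unit.
have HTH : H^T *m H = 1%:M by exact: mulmx1C.
pose M : 'M[R]_(1 + n) := H *m A *m H^T.
have M_sym : M^T = M by rewrite /M !trmx_mul trmxK A_sym mulmxA.
have M_row : row ord0 M = a *: delta_mx 0 ord0.
  by rewrite /M !row_mul Hv vA -scalemxAl -Hv -row_mul HHT row1.
have M_ur : ursubmx M = 0.
  apply/matrixP => i j; rewrite !mxE.
  have -> : lshift n i = ord0 by apply/val_inj; rewrite /= ord1.
  have /rowP/(_ (rshift 1 j)) := M_row; rewrite !mxE => ->.
  by rewrite mulr0.
have [Q [d [QQT M_dr]]] : exists (Q : 'M[R]_n) (d : 'rV[R]_n),
    Q *m Q^T = 1%:M /\ drsubmx M = Q^T *m diag_mx d *m Q.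
  by apply: IHn; rewrite trmx_drsub M_sym.
have M_block : M = block_mx (ulsubmx M) 0 0 (drsubmx M).
  rewrite -[LHS]submxK M_ur; congr block_mx.
  by rewrite -[LHS]trmxK trmx_dlsub M_sym M_ur trmx0.
pose K : 'M[R]_(1 + n) := block_mx 1%:M 0 0 Q.
have KKT : K *m K^T = 1%:M.
  rewrite tr_block_mx mulmx_block !trmx0 !trmx1.
  rewrite !(mul0mx, mulmx0, mulmx1, addr0, add0r) QQT.
  by rewrite -scalar_mx_block.
have M_diag : M = K^T *m diag_mx (row_mx (ulsubmx M) d) *m K.
  rewrite [LHS]M_block tr_block_mx diag_mx_row !mulmx_block !trmx0 !trmx1.
  rewrite !(mul0mx, mulmx0, mulmx1, mul1mx, addr0, add0r) -M_dr.
  by congr block_mx; apply/matrixP => i j; rewrite !ord1 !mxE eqxx mulr1n.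
exists (K *m H), (row_mx (ulsubmx M) d); split.
  by rewrite trmx_mul mulmxA -(mulmxA K) HHT mulmx1.
have -> : A = H^T *m M *m H.
  by rewrite /M !mulmxA HTH mul1mx -mulmxA HTH mulmx1.
by rewrite [in LHS]M_diag trmx_mul !mulmxA.
Qed.

(** * Counting eigenvalues and Sylvester's law of inertia *)

Lemma char_poly_orthogonal (R : comNzRingType) (n : nat) (Q D : 'M[R]_n) :
  Q *m Q^T = 1%:M -> char_poly (Q^T *m D *m Q) = char_poly D.
Proof.
move=> QQT; have QTQ := mulmx1C QQT; pose P := map_mx polyC Q.
have PTP : P^T *m P = 1%:M by rewrite map_trmx -map_mxM QTQ map_mx1.
have -> : char_poly (Q^T *m D *m Q) = \det (P^T *m char_poly_mx D *m P).
  rewrite /char_poly /char_poly_mx mulmxBr mulmxBl !map_mxM -map_trmx -/P.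
  by rewrite -(mulmxA _ 'X%:M) -scalar_mxC mulmxA PTP mul1mx.
by rewrite det_mulmx mulrC -det_mulmx mulmxA (mulmx1C PTP) mul1mx.
Qed.

Lemma sum_count_mem (T : eqType) (S : pred T) (r s : seq T) :
  uniq r -> {subset s <= r} ->
  (\sum_(x <- r | S x) count_mem x s = count S s)%N.
Proof.
move=> r_uniq; elim: s => [|y s IHs] sr /=; first by rewrite big1.
rewrite big_split /= IHs => [|x xs]; last by rewrite sr // inE xs orbT.
congr (_ + _)%N; rewrite big_mkcond (bigD1_seq y) ?sr ?mem_head //= eqxx.
rewrite big1 ?addn0 => [|x /negPf xy]; first by case: (S y).
by rewrite eq_sym xy if_same.
Qed.

(** A symmetric matrix has a characteristic polynomial that splits over [R],
    so the multiplicities summed by [num_eig] count diagonal entries of any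
    orthogonal diagonalization. *)
Lemma num_eig_spectral (R : realType) (n : nat) (S : pred R) (A Q : 'M[R]_n)
    (d : 'rV[R]_n) :
  Q *m Q^T = 1%:M -> A = Q^T *m diag_mx d *m Q ->
  num_eig S A = #|[pred i | S (d 0 i)]|.
Proof.
move=> QQT A_diag; pose s := [seq d 0 i | i <- enum 'I_n].
have pA : char_poly A = \prod_(a <- s) ('X - a%:P).
  rewrite A_diag char_poly_orthogonal // char_poly_trig ?diag_mx_is_trig //.
  rewrite big_map big_enum; apply: eq_bigr => i _.
  by rewrite mxE eqxx mulr1n.
have pA_neq0 : char_poly A != 0 by rewrite monic_neq0 ?char_poly_monic.
rewrite /num_eig; under eq_bigr => x _ do rewrite pA mu_prod_XsubC.
rewrite sum_count_mem ?uniq_roots //.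
  by rewrite count_map -size_filter cardE enumT.
move=> x xs; rewrite -(roots_on_rootsR pA_neq0) in_itv /=.
by rewrite pA root_prod_XsubC.
Qed.

(** The columns are the chosen basis of [W], so that the vectors of [W] are the
    products [vspace_mx W *m c]. *)
Definition vspace_mx (F : fieldType) (m : nat) (W : {vspace 'cV[F]_m}) :
  'M[F]_(m, \dim W) := \matrix_(i, j) (vbasis W)`_j i 0.

Lemma mul_vspace_mx (F : fieldType) (m : nat) (W : {vspace 'cV[F]_m})
    (c : 'cV[F]_(\dim W)) :
  vspace_mx W *m c = \sum_j c j 0 *: (vbasis W)`_j.
Proof.
apply/colP => i; rewrite mxE summxE; apply: eq_bigr => j _.
by rewrite !mxE mulrC.
Qed.

Lemma vspace_mxP (F : fieldType) (m : nat) (W : {vspace 'cV[F]_m})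
    (x : 'cV[F]_m) :
  reflect (exists c, x = vspace_mx W *m c) (x \in W).
Proof.
apply: (iffP idP) => [/coord_vbasis xE | [c ->]]; last first.
  rewrite mul_vspace_mx rpred_sum // => j _.
  by rewrite rpredZ // vbasis_mem // mem_nth // size_tuple.
exists (\col_j coord (vbasis W) j x).
by rewrite mul_vspace_mx {1}xE; apply: eq_bigr => j _; rewrite mxE.
Qed.

Lemma vspace_mx_inj (F : fieldType) (m : nat) (W : {vspace 'cV[F]_m})
    (c : 'cV[F]_(\dim W)) : vspace_mx W *m c = 0 -> c = 0.
Proof.
rewrite mul_vspace_mx => sum0; apply/colP => j; rewrite mxE.
exact: (freeP (basis_free (vbasisP W)) _ sum0).
Qed.

(** If the coordinates selected by [P] determine the vectors of [W], then
    [W] embeds in the space of these coordinates. *)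
Lemma dim_le_coordinates (F : fieldType) (m : nat) (W : {vspace 'cV[F]_m})
    (Q : 'M[F]_m) (P : pred 'I_m) :
  (forall w, w \in W -> (forall i, P i -> (Q *m w) i 0 = 0) -> w = 0) ->
  (\dim W <= #|P|)%N.
Proof.
move=> W_inj; pose N := rowsub (@enum_val _ P) (Q *m vspace_mx W).
suff /eqP <- : row_free N^T by exact: rank_leq_col.
apply: inj_row_free => c cN; apply: trmx_inj; rewrite trmx0.
apply: vspace_mx_inj; apply: W_inj => [|i Pi].
  by apply/vspace_mxP; exists c^T.
have := congr1 trmx cN; rewrite trmx_mul trmxK trmx0 /N mul_rowsub_mx -mulmxA.
by move=> /colP/(_ (enum_rank_in Pi i)); rewrite !mxE enum_rankK_in.
Qed.

Lemma inner_trE (R : realType) (m : nat) (B C : 'M[R]_m) (x y : 'cV[R]_m) :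
  inner x (B^T *m C *m y) = inner (B *m x) (C *m y).
Proof. by rewrite /inner trmx_mul !mulmxA. Qed.

Lemma quadratic_spectral (R : realType) (n : nat) (A Q : 'M[R]_n)
    (d : 'rV[R]_n) (w : 'cV[R]_n) : A = Q^T *m diag_mx d *m Q ->
  inner w (A *m w) = \sum_i d 0 i * (Q *m w) i 0 ^+ 2.
Proof.
move=> ->; rewrite -!mulmxA [_ *m (_ *m _)]mulmxA inner_trE.
rewrite /inner mxE; apply: eq_bigr => i _.
by rewrite mxE mul_diag_mx mxE mulrCA expr2.
Qed.

(** One half of the law of inertia.  In orthonormal eigencoordinates [y] the
    quadratic form is the sum of the [d i * y i ^ 2]; on a vector whose
    coordinates with [d i > 0] vanish it is nonpositive, so in [W] only [0] is
    such a vector. *)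
Lemma dim_posdef_le (R : realType) (n : nat) (A : 'M[R]_n)
    (W : {vspace 'cV[R]_n}) :
  A^T = A -> posdef_on A W -> (\dim W <= num_pos_eig A)%N.
Proof.
move=> /symmetric_spectral[Q [d [QQT A_diag]]] A_pos.
rewrite /num_pos_eig (num_eig_spectral _ QQT A_diag).
apply: (dim_le_coordinates (Q := Q)) => w wW w_coord; apply/eqP.
apply: contraTT isT => /(A_pos w wW); rewrite (quadratic_spectral w A_diag).
rewrite ltNge sumr_le0 // => i _; have [di_gt0|di_le0] := ltrP 0 (d 0 i).
  by rewrite w_coord // expr0n mulr0.
by rewrite mulr_le0_ge0 ?sqr_ge0.
Qed.

Lemma dim_negdef_le (R : realType) (n : nat) (A : 'M[R]_n)
    (W : {vspace 'cV[R]_n}) :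
  A^T = A -> negdef_on A W -> (\dim W <= num_neg_eig A)%N.
Proof.
move=> /symmetric_spectral[Q [d [QQT A_diag]]] A_neg.
rewrite /num_neg_eig (num_eig_spectral _ QQT A_diag).
apply: (dim_le_coordinates (Q := Q)) => w wW w_coord; apply/eqP.
apply: contraTT isT => /(A_neg w wW).
rewrite mulNmx /inner mulmxN mxE -/(inner _ _) (quadratic_spectral w A_diag).
rewrite oppr_gt0 ltNge sumr_ge0 // => i _.
have [di_lt0|di_ge0] := ltrP (d 0 i) 0.
  by rewrite w_coord // expr0n mulr0.
by rewrite mulr_ge0 ?sqr_ge0.
Qed.

Lemma dim_null_le (R : realType) (n : nat) (A : 'M[R]_n)
    (W : {vspace 'cV[R]_n}) :
  A^T = A -> (forall w, w \in W -> A *m w = 0) ->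
  (\dim W <= num_zero_eig A)%N.
Proof.
move=> /symmetric_spectral[Q [d [QQT A_diag]]] A0.
rewrite /num_zero_eig (num_eig_spectral _ QQT A_diag).
apply: (dim_le_coordinates (Q := Q)) => w wW w_coord.
rewrite -[w]mul1mx -(mulmx1C QQT) -mulmxA.
suff -> : Q *m w = 0 by rewrite mulmx0.
apply/colP => i; rewrite [RHS]mxE.
have [di0|di_neq0] := eqVneq (d 0 i) 0; first by apply: w_coord; rewrite /= di0.
have /colP/(_ i) : diag_mx d *m (Q *m w) = 0.
  by rewrite -[RHS](mulmx0 _ Q) -(A0 w wW) A_diag !mulmxA QQT mul1mx.
by rewrite mul_diag_mx !mxE => /eqP; rewrite mulf_eq0 (negPf di_neq0) => /eqP.
Qed.

(** This turns upper bounds on the dimensions of the three summands of a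
    decomposition of the whole space into equalities. *)
Lemma sum_num_eig (R : realType) (n : nat) (A : 'M[R]_n) :
  A^T = A -> (num_neg_eig A + num_zero_eig A + num_pos_eig A = n)%N.
Proof.
move=> /symmetric_spectral[Q [d [QQT A_diag]]].
rewrite /num_neg_eig /num_zero_eig /num_pos_eig !(num_eig_spectral _ QQT A_diag).
rewrite -[RHS]card_ord -!sum1_card.
rewrite big_mkcond [X in (_ + X + _)%N]big_mkcond [X in (_ + X)%N]big_mkcond /=.
rewrite -!big_split /=; apply: eq_bigr => i _.
by rewrite !inE; case: (ltrgtP (d 0 i) 0).
Qed.

(** * Symplectic orthogonal projections *)

Lemma eq_mulmx_col (R : pzRingType) (m n : nat) (A B : 'M[R]_(m, n)) :
  (forall x : 'cV_n, A *m x = B *m x) -> A = B.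
Proof.
move=> AB; apply/matrixP => i j.
by have /colP/(_ i) := AB (delta_mx j 0); rewrite -!colE !mxE.
Qed.

Lemma trmx_Jmx (R : realType) (n : nat) : (Jmx R n)^T = - Jmx R n.
Proof.
rewrite /Jmx tr_block_mx !trmx0 trmx1 raddfN /= trmx1.
by rewrite opp_block_mx !oppr0 opprK.
Qed.

Lemma mul_Jmx_Jmx (R : realType) (n : nat) : Jmx R n *m Jmx R n = - 1%:M.
Proof.
rewrite /Jmx mulmx_block !(mul0mx, mulmx0, mul1mx, mulmx1, addr0, add0r).
by rewrite (scalar_mx_block n n 1) opp_block_mx !oppr0.
Qed.

Lemma mul_Jmx_inj (R : realType) (n m : nat) (X : 'M[R]_(n + n, m)) :
  Jmx R n *m X = 0 -> X = 0.
Proof.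
move=> JX0; apply: oppr_inj; rewrite oppr0 -[- X]mul1mx mulmxN -mulNmx.
by rewrite -mul_Jmx_Jmx -mulmxA JX0 mulmx0.
Qed.

(** Membership in the symplectic complement becomes one matrix equation, which
    makes the explicit formula for the projection work. *)
Lemma in_symp_perpE (R : realType) (n : nat) (W : {vspace 'cV[R]_(n + n)})
    (u : 'cV[R]_(n + n)) :
  in_symp_perp W u <-> (vspace_mx W)^T *m Jmx R n *m u = 0.
Proof.
have trE : (vspace_mx W)^T *m Jmx R n *m u =
           - (u^T *m Jmx R n *m vspace_mx W)^T.
  by rewrite !trmx_mul trmxK trmx_Jmx mulNmx mulmxN opprK mulmxA.
rewrite trE; split=> [uW | /eqP]; last first.
  rewrite oppr_eq0 => /eqP/(congr1 trmx); rewrite trmxK trmx0 => uB0.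
  move=> v /vspace_mxP[c ->].
  by rewrite /inner !mulmxA uB0 mul0mx mxE.
suff -> : u^T *m Jmx R n *m vspace_mx W = 0 by rewrite trmx0 oppr0.
apply/rowP => j; rewrite [RHS]mxE -(uW (vspace_mx W *m delta_mx j 0)).
  by rewrite /inner !mulmxA -colE [RHS]mxE.
by apply/vspace_mxP; exists (delta_mx j 0).
Qed.

(** If the columns of [B] form a basis of [W], then the coefficients [c] of the
    component of [x] in [W] solve [B^T J (x - B c) = 0], that is
    [c = (B^T J B)^-1 B^T J x].  The definition is locked so that rewriting with
    associativity does not look inside the product. *)
HB.lock
Definition symp_proj (R : realType) (n : nat) (W : {vspace 'cV[R]_(n + n)}) :
    'M[R]_(n + n) :=
  let B := vspace_mx W in
  B *m invmx (B^T *m Jmx R n *m B) *m B^T *m Jmx R n.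

Lemma symp_proj_in (R : realType) (n : nat) (W : {vspace 'cV[R]_(n + n)})
    (x : 'cV[R]_(n + n)) : symp_proj W *m x \in W.
Proof. by rewrite symp_proj.unlock /= -!mulmxA; apply/vspace_mxP; eexists. Qed.

(** The kernel of the Gram matrix of the symplectic form on [W] consists of the
    coordinates of the vectors of [W] orthogonal to all of [W]; these vanish
    exactly because [W] is a symplectic subspace. *)
Lemma symp_gram_unit (R : realType) (n : nat) (W : {vspace 'cV[R]_(n + n)}) :
  symplectic_subspace W ->
  (vspace_mx W)^T *m Jmx R n *m vspace_mx W \in unitmx.
Proof.
move=> W_symp; rewrite -unitmx_tr -row_free_unit; apply: inj_row_free => c.
move=> /(congr1 trmx); rewrite trmx_mul trmxK trmx0 -mulmxA => Bc_perp.
apply: trmx_inj; rewrite trmx0; apply: vspace_mx_inj; apply: W_symp.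
  by apply/vspace_mxP; exists c^T.
by apply/in_symp_perpE; rewrite mulmxA -(mulmxA _ (Jmx R n)).
Qed.

Lemma symp_proj_perp (R : realType) (n : nat) (W : {vspace 'cV[R]_(n + n)})
    (x : 'cV[R]_(n + n)) :
  symplectic_subspace W -> in_symp_perp W (x - symp_proj W *m x).
Proof.
move=> W_symp; apply/in_symp_perpE; rewrite mulmxBr symp_proj.unlock /= !mulmxA.
by rewrite mulmxV ?symp_gram_unit // mul1mx subrr.
Qed.

Lemma symp_projP (R : realType) (n : nat) (W : {vspace 'cV[R]_(n + n)}) :
  symplectic_subspace W -> symp_proj_onto W (symp_proj W).
Proof.
move=> W_symp; split=> [_ /vspace_mxP[c ->] | x /in_symp_perpE xW].
  rewrite symp_proj.unlock /=; set B := vspace_mx W; set G := B^T *m _ *m B.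
  rewrite -!mulmxA.
  have <- : G *m c = B^T *m (Jmx R n *m (B *m c)) by rewrite !mulmxA.
  by rewrite mulKmx ?symp_gram_unit.
by rewrite symp_proj.unlock /= -!mulmxA (mulmxA _^T _ x) xW !mulmx0.
Qed.

(** Every vector is the sum of its projection and of a vector of the symplectic
    complement, so the two defining conditions leave no freedom. *)
Lemma symp_proj_unique (R : realType) (n : nat) (W : {vspace 'cV[R]_(n + n)})
    (P : 'M[R]_(n + n)) :
  symplectic_subspace W -> symp_proj_onto W P -> P = symp_proj W.
Proof.
move=> W_symp [PW Pperp]; apply: eq_mulmx_col => x.
rewrite -{1}[x](subrK (symp_proj W *m x)) mulmxDr.
by rewrite Pperp ?add0r ?PW ?symp_proj_in //; apply: symp_proj_perp.
Qed.

(** The projection is self-adjoint for the symplectic form, because the Gram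
    matrix and its inverse are skew-symmetric, like [J]. *)
Lemma symp_proj_selfadjoint (R : realType) (n : nat)
    (W : {vspace 'cV[R]_(n + n)}) :
  symplectic_subspace W ->
  (symp_proj W)^T *m Jmx R n = Jmx R n *m symp_proj W.
Proof.
move=> /symp_gram_unit.
rewrite symp_proj.unlock /=; set B := vspace_mx W; set G := B^T *m _ *m B => G_unit.
have GT : G^T = -1 *: G.
  by rewrite /G !trmx_mul trmxK trmx_Jmx mulNmx mulmxN mulmxA scaleN1r.
rewrite !trmx_mul trmxK trmx_inv GT invmxZ -?GT ?unitmx_tr // invrN1.
by rewrite trmx_Jmx scaleN1r !(mulNmx, mulmxN) opprK !mulmxA.
Qed.

Lemma symp_disjoint (R : realType) (n : nat) (W Z : {vspace 'cV[R]_(n + n)}) :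
  symplectic_subspace W -> symp_orthogonal W Z -> (W :&: Z = 0)%VS.
Proof.
move=> W_symp WZ; apply/eqP; rewrite -subv0; apply/subvP => x.
rewrite memv_cap => /andP[xW xZ]; rewrite memv0; apply/eqP.
by apply: W_symp => //; apply: WZ.
Qed.

Lemma inner_Jmx_skew (R : realType) (n : nat) (x y : 'cV[R]_(n + n)) :
  inner x (Jmx R n *m y) = - inner y (Jmx R n *m x).
Proof.
have -> : - inner y (Jmx R n *m x) = (- (y^T *m (Jmx R n *m x)))^T 0 0.
  by rewrite /inner [RHS]mxE [RHS]mxE.
by rewrite raddfN /= !trmx_mul trmxK trmx_Jmx mulmxN mulNmx opprK -mulmxA.
Qed.

Lemma symp_orthogonal_sym (R : realType) (n : nat)
    (W Z : {vspace 'cV[R]_(n + n)}) :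
  symp_orthogonal W Z -> symp_orthogonal Z W.
Proof.
by move=> WZ w wW z zZ; rewrite inner_Jmx_skew (WZ z zZ w wW) oppr0.
Qed.

Lemma mxendE (R : realType) (m : nat) (A : 'M[R]_m) (x : 'cV[R]_m) :
  mxend A x = A *m x.
Proof. by rewrite /mxend lfunE. Qed.

Lemma mem_mxker (R : realType) (m : nat) (A : 'M[R]_m) (x : 'cV[R]_m) :
  (x \in mxker A) = (A *m x == 0).
Proof. by rewrite memv_ker mxendE. Qed.

Lemma mxrange_symp_proj (R : realType) (n : nat) (W : {vspace 'cV[R]_(n + n)}) :
  symplectic_subspace W -> mxrange (symp_proj W) = W.
Proof.
move=> /symp_projP[PW _]; apply/vspaceP => x; apply/memv_imgP/idP.
  by move=> [y _ ->]; rewrite mxendE symp_proj_in.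
by move=> xW; exists x; rewrite ?memvf ?mxendE ?PW.
Qed.

Lemma symp_proj_idem (R : realType) (n : nat) (W : {vspace 'cV[R]_(n + n)}) :
  symplectic_subspace W -> symp_proj W *m symp_proj W = symp_proj W.
Proof.
move=> W_symp; apply: eq_mulmx_col => x; rewrite -mulmxA.
by rewrite (symp_projP W_symp).1 ?symp_proj_in.
Qed.

Lemma symp_proj_mul0P (R : realType) (n : nat)
    (W Z : {vspace 'cV[R]_(n + n)}) :
  symplectic_subspace W -> symplectic_subspace Z ->
  symp_proj W *m symp_proj Z = 0 <-> symp_orthogonal W Z.
Proof.
move=> W_symp Z_symp; split=> [PP0 z zZ | WZ].
  have -> : z = z - symp_proj W *m z.
    by rewrite -((symp_projP Z_symp).1 z zZ) mulmxA PP0 mul0mx subr0.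
  exact: symp_proj_perp.
apply: eq_mulmx_col => x; rewrite mul0mx -mulmxA.
by apply: (symp_projP W_symp).2; apply: WZ; apply: symp_proj_in.
Qed.

(** The second form of self-adjointness, obtained from [J *m J = - 1]; it moves
    [J] past a transposed projection in [J P^T A]. *)
Lemma symp_proj_mulJ (R : realType) (n : nat) (W : {vspace 'cV[R]_(n + n)}) :
  symplectic_subspace W ->
  symp_proj W *m Jmx R n = Jmx R n *m (symp_proj W)^T.
Proof.
move=> W_symp; apply/eqP; rewrite -subr_eq0; apply/eqP; apply: mul_Jmx_inj.
rewrite mulmxBr !mulmxA -symp_proj_selfadjoint // -(mulmxA _^T) mul_Jmx_Jmx.
by rewrite mulmxN mulmx1 mulNmx mul1mx subrr.
Qed.

Lemma dim_colspace (R : realType) (m : nat) : \dim {: 'cV[R]_m} = m.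
Proof. by rewrite dimvf /dim /= muln1. Qed.

(** Pairwise orthogonal symplectic subspaces are in direct sum, so the
    dimension hypothesis makes them span everything, and on each of them the
    sum of the projections is the identity. *)
Lemma sum_symp_proj_eq1 (R : realType) (n : nat)
    (U V W : {vspace 'cV[R]_(n + n)}) :
  symplectic_subspace U -> symplectic_subspace V -> symplectic_subspace W ->
  symp_orthogonal U V -> symp_orthogonal U W -> symp_orthogonal V W ->
  (\dim U + \dim V + \dim W = n + n)%N ->
  symp_proj U + symp_proj V + symp_proj W = 1%:M.
Proof.
move=> U_symp V_symp W_symp UV UW VW dimE.
have UV0 : (U :&: V = 0)%VS by exact: symp_disjoint.
have UVW0 : ((U + V) :&: W = 0)%VS.
  rewrite capvC; apply: symp_disjoint => // _ /memv_addP[u uU [v vV ->]] w wW.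
  rewrite /inner linearD /= mulmxDl mxE.
  rewrite -!/(inner _ _) (symp_orthogonal_sym UW uU wW).
  by rewrite (symp_orthogonal_sym VW vV wW) addr0.
have sumT : (U + V + W = fullv)%VS.
  apply/eqP; rewrite eqEdim subvf dim_colspace.
  by rewrite !dimv_disjoint_sum // dimE leqnn.
have mul0 (X Y : {vspace 'cV[R]_(n + n)}) :
    symplectic_subspace X -> symp_orthogonal X Y ->
    forall y, y \in Y -> symp_proj X *m y = 0.
  by move=> X_symp XY y yY; apply: (symp_projP X_symp).2; apply: XY.
apply: eq_mulmx_col => x; rewrite mul1mx.
have /memv_addP[_ /memv_addP[u uU [v vV ->]] [w wW ->]] : x \in (U + V + W)%VS.
  by rewrite sumT memvf.
rewrite !mulmxDl !mulmxDr.
rewrite ((symp_projP U_symp).1 u uU) ((symp_projP V_symp).1 v vV).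
rewrite ((symp_projP W_symp).1 w wW).
rewrite (mul0 U V U_symp UV v vV) (mul0 U W U_symp UW w wW).
rewrite (mul0 V W V_symp VW w wW).
rewrite (mul0 V U V_symp (symp_orthogonal_sym UV) u uU).
rewrite (mul0 W U W_symp (symp_orthogonal_sym UW) u uU).
rewrite (mul0 W V W_symp (symp_orthogonal_sym VW) v vV).
by rewrite !addr0 !add0r.
Qed.

Lemma dim_ge_sum_symp_proj (R : realType) (n : nat)
    (U V W : {vspace 'cV[R]_(n + n)}) :
  symp_proj U + symp_proj V + symp_proj W = 1%:M ->
  (n + n <= \dim U + \dim V + \dim W)%N.
Proof.
move=> sum1; rewrite -{1}(dim_colspace R (n + n)).
have -> : fullv = (U + V + W)%VS.
  apply/eqP; rewrite eqEsubv subvf andbT; apply/subvP => x _.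
  rewrite -[x]mul1mx -sum1 !mulmxDl.
  by rewrite !memv_add ?symp_proj_in.
apply: leq_trans (dimv_add_leqif _ _) _.
by rewrite leq_add2r; apply: dimv_add_leqif.
Qed.

(** * The two implications *)

(** The dimensions of the three subspaces add up to that of the whole space, so
    their projections sum to the identity.  Expanding [A] between the two copies
    of this identity leaves nine blocks: those involving [P0] vanish because
    [A P0 = 0], and the two mixed blocks because [J A] preserves [Wp], which
    gives [J Pm^T A Pp = Pm J A Pp = 0], and because [A] is symmetric. *)
Lemma SpS_projections (R : realType) (n : nat) (A : 'M[R]_(n + n)) :
  SpS A ->
  exists Pm P0 Pp : 'M[R]_(n + n),
    [/\ [/\ symp_orth_projection Pm, symp_orth_projection P0
          & symp_orth_projection Pp],
        [/\ Pm *m P0 = 0, Pm *m Pp = 0, P0 *m Pp = 0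
          & Pm + P0 + Pp = 1%:M],
        A = Pm^T *m A *m Pm + Pp^T *m A *m Pp
      & negdef_on (Pm^T *m A *m Pm) (mxrange Pm) /\
        posdef_on (Pp^T *m A *m Pp) (mxrange Pp)].
Proof.
move=> [A_sym [Wm [W0 [Wp []]]]] [Sm S0 Sp] [m0 mp zp] [dm d0 dp].
move=> [_ _ invp] [neg ker pos].
have sum1 : symp_proj Wm + symp_proj W0 + symp_proj Wp = 1%:M.
  by apply: sum_symp_proj_eq1 => //; rewrite dm d0 dp sum_num_eig.
have AP0 : A *m symp_proj W0 = 0.
  apply: eq_mulmx_col => x; rewrite mul0mx -mulmxA; apply/eqP.
  by rewrite -mem_mxker ker symp_proj_in.
have Pmp0 : (symp_proj Wm)^T *m A *m symp_proj Wp = 0.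
  apply: mul_Jmx_inj; rewrite !mulmxA -symp_proj_mulJ //.
  apply: eq_mulmx_col => x; rewrite mul0mx -!mulmxA.
  apply: (symp_projP Sm).2; apply: mp; rewrite mulmxA -mxendE.
  by apply: (subvP invp); rewrite memv_img // symp_proj_in.
have Ppm0 : (symp_proj Wp)^T *m A *m symp_proj Wm = 0.
  by apply: trmx_inj; rewrite !trmx_mul trmxK A_sym mulmxA Pmp0 trmx0.
have P0A : (symp_proj W0)^T *m A = 0.
  by apply: trmx_inj; rewrite trmx_mul trmxK A_sym AP0 trmx0.
exists (symp_proj Wm), (symp_proj W0), (symp_proj Wp); split.
- by split; [exists Wm | exists W0 | exists Wp]; split=> //; apply: symp_projP.
- by split=> //; apply/symp_proj_mul0P.
- rewrite -{1}[A]mulmx1 -{1}[A]mul1mx -{1}trmx1 -sum1.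
  rewrite [(_ + _)^T]raddfD /= [(_ + _)^T]raddfD /= !mulmxDl !mulmxDr.
  rewrite P0A Pmp0 Ppm0 -!(mulmxA _ A) AP0.
  by rewrite !(mul0mx, mulmx0, addr0, add0r).
- rewrite !mxrange_symp_proj //; split=> w wW w_neq0.
    rewrite -mulNmx -mulmxN -(mulmxA _ (symp_proj Wm)) inner_trE.
    by rewrite (symp_projP Sm).1 //; apply: neg.
  rewrite -(mulmxA _ (symp_proj Wp)) inner_trE (symp_projP Sp).1 //.
  exact: pos.
Qed.

(** The ranges of the projections are the required subspaces.  The splitting of
    [A] gives [A P = P^T A P] for each of them, hence
    [J A P = J P^T A P = P J A P], which is invariance; transposing,
    [A P = P^T A], so the projections preserve [ker A], which by definiteness
    meets [Wm] and [Wp] trivially.  The law of inertia bounds the three dimensions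
    by the numbers of eigenvalues, whose sum is the dimension of the space, so
    the bounds are attained. *)
Lemma projections_SpS (R : realType) (n : nat) (A Pm P0 Pp : 'M[R]_(n + n)) :
  A^T = A ->
  symp_orth_projection Pm -> symp_orth_projection P0 ->
  symp_orth_projection Pp ->
  Pm *m P0 = 0 -> Pm *m Pp = 0 -> P0 *m Pp = 0 -> Pm + P0 + Pp = 1%:M ->
  A = Pm^T *m A *m Pm + Pp^T *m A *m Pp ->
  negdef_on (Pm^T *m A *m Pm) (mxrange Pm) ->
  posdef_on (Pp^T *m A *m Pp) (mxrange Pp) -> SpS A.
Proof.
move=> A_sym [Wm [Sm /(symp_proj_unique Sm) ->]].
move=> [W0 [S0 /(symp_proj_unique S0) ->]] [Wp [Sp /(symp_proj_unique Sp) ->]].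
move=> /(symp_proj_mul0P Sm S0) m0 /(symp_proj_mul0P Sm Sp) mp.
move=> /(symp_proj_mul0P S0 Sp) zp sum1 A_split.
rewrite !mxrange_symp_proj // => neg pos.
have Pmp : symp_proj Wm *m symp_proj Wp = 0 by apply/symp_proj_mul0P.
have Pm0 : symp_proj Wm *m symp_proj W0 = 0 by apply/symp_proj_mul0P.
have Ppm : symp_proj Wp *m symp_proj Wm = 0.
  by apply/symp_proj_mul0P => //; apply: symp_orthogonal_sym.
have Pp0 : symp_proj Wp *m symp_proj W0 = 0.
  by apply/symp_proj_mul0P => //; apply: symp_orthogonal_sym.
have APm : A *m symp_proj Wm = (symp_proj Wm)^T *m A *m symp_proj Wm.
  rewrite {1}A_split mulmxDl -[in LHS]mulmxA symp_proj_idem //.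
  by rewrite -[X in _ + X]mulmxA Ppm mulmx0 addr0.
have APp : A *m symp_proj Wp = (symp_proj Wp)^T *m A *m symp_proj Wp.
  rewrite {1}A_split mulmxDl -[in LHS]mulmxA Pmp mulmx0 add0r.
  by rewrite -[LHS]mulmxA symp_proj_idem.
have AP0 : A *m symp_proj W0 = 0.
  rewrite {1}A_split mulmxDl -[in LHS]mulmxA Pm0 mulmx0 add0r.
  by rewrite -[LHS]mulmxA Pp0 mulmx0.
have {}neg : negdef_on A Wm.
  move=> w wW w_neq0; have := neg w wW w_neq0.
  rewrite -mulNmx -mulmxN -(mulmxA _ (symp_proj Wm)) inner_trE.
  by rewrite (symp_projP Sm).1.
have {}pos : posdef_on A Wp.
  move=> w wW w_neq0; have := pos w wW w_neq0.
  by rewrite -(mulmxA _ (symp_proj Wp)) inner_trE (symp_projP Sp).1.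
have nul w : w \in W0 -> A *m w = 0.
  by move=> wW; rewrite -((symp_projP S0).1 w wW) mulmxA AP0 mul0mx.
have inv (W : {vspace 'cV[R]_(n + n)}) : symplectic_subspace W ->
    A *m symp_proj W = (symp_proj W)^T *m A *m symp_proj W ->
    mxinvariant (Jmx R n *m A) W.
  move=> W_symp AP; apply/subvP => _ /memv_imgP[w wW ->].
  rewrite mxendE -((symp_projP W_symp).1 w wW) mulmxA -(mulmxA _ A) AP !mulmxA.
  by rewrite -symp_proj_mulJ // -!mulmxA symp_proj_in.
have := dim_ge_sum_symp_proj sum1.
have := dim_negdef_le A_sym neg; have := dim_null_le A_sym nul.
have := dim_posdef_le A_sym pos; have := sum_num_eig A_sym.
move=> dim_sum dim_p dim_0 dim_m dim_ge.
split=> //; exists Wm, W0, Wp; split=> //.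
- by split; lia.
- split; apply: inv => //; first by rewrite -mulmxA AP0 mulmx0.
split=> //; apply/vspaceP => x; rewrite mem_mxker.
apply/eqP/idP=> [Ax0|]; last exact: nul.
have A_proj0 (W : {vspace 'cV[R]_(n + n)}) :
    A *m symp_proj W = (symp_proj W)^T *m A *m symp_proj W ->
    A *m (symp_proj W *m x) = 0.
  move=> AP; have /(congr1 trmx) := AP.
  rewrite !trmx_mul trmxK A_sym [X in _ = X]mulmxA -AP => PA.
  by rewrite mulmxA -PA -mulmxA Ax0 mulmx0.
have Pmx : symp_proj Wm *m x = 0.
  apply/eqP; apply: contraTT isT => /(neg _ (symp_proj_in Wm x)).
  by rewrite mulNmx A_proj0 // oppr0 /inner mulmx0 mxE ltxx.
have Ppx : symp_proj Wp *m x = 0.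
  apply/eqP; apply: contraTT isT => /(pos _ (symp_proj_in Wp x)).
  by rewrite A_proj0 // /inner mulmx0 mxE ltxx.
by rewrite -[x]mul1mx -sum1 !mulmxDl Pmx Ppx add0r addr0 symp_proj_in.
Qed.

Theorem proposition4p4 (R : realType) (n : nat) (A : 'M[R]_(n + n))
  (A_sym : A^T = A) :
  SpS A <->
  exists Pm P0 Pp : 'M[R]_(n + n),
    [/\ [/\ symp_orth_projection Pm, symp_orth_projection P0
          & symp_orth_projection Pp],
        [/\ Pm *m P0 = 0, Pm *m Pp = 0, P0 *m Pp = 0
          & Pm + P0 + Pp = 1%:M],
        A = Pm^T *m A *m Pm + Pp^T *m A *m Pp
      & negdef_on (Pm^T *m A *m Pm) (mxrange Pm) /\
        posdef_on (Pp^T *m A *m Pp) (mxrange Pp)].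
Proof.
split; first exact: SpS_projections.
move=> [Pm [P0 [Pp [[Sm S0 Sp] [m0 mp zp sum1] A_split [neg pos]]]]].
exact: (projections_SpS A_sym Sm S0 Sp m0 mp zp sum1 A_split neg pos).
Qed.
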